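(* There exist base sequences $BS(40,39)$; that is, there exist four sequences $A,B,C,D$ with all terms in $\{+1,-1\}$, with $A$ and $B$ of length $40$ and $C$ and $D$ of length $39$, such that $N_A(s)+N_B(s)+N_C(s)+N_D(s)=0$ for every integer $s\ge 1$.
   Context: For a finite integer sequence $X=(x_1,\ldots,x_\ell)$, its nonperiodic autocorrelation function is $N_X(s)=\sum_{i=1}^{\ell-s}x_i x_{i+s}$ for integers $s\ge 0$, with the convention that $N_X(s)=0$ for $s\ge \ell$. Base sequences $BS(m,n)$ are quadruples $(A;B;C;D)$ of $\{+1,-1\}$-sequences, with $A,B$ of length $m$ and $C,D$ of length $n$, such that $N_A(s)+N_B(s)+N_C(s)+N_D(s)=0$ for all $s\ge 1$. *)

(* Defs.v *)
From mathcomp Require Import all_boot all_order all_algebra.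

Set Implicit Arguments.
Unset Strict Implicit.
Unset Printing Implicit Defensive.

Import GRing.Theory Num.Theory.

Local Open Scope ring_scope.

(* Nonperiodic autocorrelation N_X(s), with indices shifted to start from 0.
   For s >= size X the truncated subtraction makes the range empty, which gives
   the convention N_X(s) = 0. *)
Definition autocorr (X : seq int) (s : nat) : int :=
  \sum_(0 <= i < size X - s) X`_i * X`_(i + s)%N.

Definition binary_seq (l : nat) (X : seq int) : Prop :=
  size X = l /\ forall x : int, x \in X -> x = 1 \/ x = -1.

Definition base_sequences (m n : nat) (A B C D : seq int) : Prop :=
  [/\ binary_seq m A /\ binary_seq m B,
      binary_seq n C /\ binary_seq n D
    & forall s : nat, (1 <= s)%N ->
        autocorr A s + autocorr B s + autocorr C s + autocorr D s = 0].

(* Main.v *)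
Require Import Defs.
From mathcomp Require Import all_boot all_order all_algebra.

Import GRing.Theory.
Local Open Scope ring_scope.

(** The theorem holds because of one explicit quadruple, [seqA], [seqB],
    [seqC], [seqD]. Only the lags [1 <= s < 40] need attention, since the
    autocorrelations vanish beyond the length ([autocorr_ge_size]); these 39
    sums of products are evaluated ([base_seqs_autocorr]), after the iterated
    sum has been rewritten as a fold that reduces ([autocorr_foldr]).

    Where the quadruple comes from. With 1-based indices, the condition at lag
    [s] says that a sum of [158 - 4 s] signs is zero, so an odd number of these
    signs are [-1]. Comparing these parities for all lags forces
    [a_i a_(41-i) b_i b_(41-i) = 1] for [2 <= i <= 20], [= -1] for [i = 1], and
    [c_i c_(40-i) d_i d_(40-i) = 1] for [1 <= i <= 19]: the pairs [(A, B)]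
    and [(C, D)] are found by joining lists of single sequences on their
    reflection products [x_i x_(l+1-i)]. Summing each sequence over the residue
    classes of indices modulo 8 gives four integer vectors of length 8 whose
    periodic autocorrelations add up to 158 at shift 0 and to 0 elsewhere.
    Moreover [|A(z)|^2 + |B(z)|^2 + |C(z)|^2 + |D(z)|^2 = 158] for the
    generating polynomials on the unit circle, so a pair with
    [|A(z)|^2 + |B(z)|^2 > 158] for some [z] is useless, and likewise for
    [(C, D)]. Within the classes of fixed residue sums, the surviving pairs
    [(A, B)] and [(C, D)] are then matched on their autocorrelations, which
    must be opposite at all nonzero lags. *)

(** * Autocorrelation of integer sequences *)

Lemma autocorr_ge_size (X : seq int) (s : nat) :
  (size X <= s)%N -> autocorr X s = 0.
Proof. by rewrite /autocorr -subn_eq0 => /eqP->; rewrite big_geq. Qed.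

(** Iterated sums are opaque to reduction; this form computes. *)
Lemma autocorr_foldr (X : seq int) (s : nat) :
  autocorr X s =
  foldr (fun i acc => X`_i * X`_(i + s)%N + acc) 0 (iota 0 (size X - s)).
Proof.
rewrite /autocorr /index_iota subn0.
elim: (iota _ _) => [|i r IHr] /=; first by rewrite big_nil.
by rewrite big_cons IHr.
Qed.

Lemma binary_seqP (X : seq int) :
  all (pred2 1 (-1)) X -> binary_seq (size X) X.
Proof. by move=> /allP X_pm1; split=> // x /X_pm1 /pred2P. Qed.

(** * The quadruple *)

Definition seqA : seq int :=
  [::  1;  1;  1;  1;  1; -1; -1;  1; -1; -1;
      -1;  1;  1;  1; -1;  1;  1;  1; -1;  1;
      -1;  1; -1; -1; -1; -1; -1;  1; -1;  1;
      -1;  1; -1; -1; -1; -1;  1;  1;  1; -1].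

Definition seqB : seq int :=
  [:: -1; -1;  1;  1; -1;  1;  1;  1; -1;  1;
      -1; -1;  1;  1;  1; -1; -1; -1;  1; -1;
       1; -1;  1;  1;  1;  1; -1;  1;  1;  1;
       1;  1; -1;  1;  1;  1;  1;  1; -1; -1].

Definition seqC : seq int :=
  [:: -1;  1;  1; -1; -1;  1;  1; -1; -1;  1;
       1; -1;  1; -1; -1;  1; -1; -1;  1;  1;
      -1;  1; -1;  1;  1; -1;  1; -1;  1;  1;
      -1;  1; -1; -1; -1; -1; -1; -1;  1].

Definition seqD : seq int :=
  [:: -1; -1;  1; -1; -1;  1;  1;  1; -1; -1;
       1; -1;  1;  1;  1; -1; -1;  1; -1;  1;
       1; -1; -1; -1; -1;  1;  1; -1;  1; -1;
      -1; -1; -1; -1; -1; -1; -1;  1;  1].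

Lemma base_seqs_autocorr (s : nat) : s \in iota 1 39 ->
  autocorr seqA s + autocorr seqB s + autocorr seqC s + autocorr seqD s = 0.
Proof.
move=> s_in; apply/eqP; rewrite !autocorr_foldr.
by move: s s_in; apply/allP; vm_compute.
Qed.

Theorem mainTheorem2 :
  exists A B C D : seq int, base_sequences 40 39 A B C D.
Proof.
exists seqA, seqB, seqC, seqD; split.
- by split; apply: binary_seqP; vm_compute.
- by split; apply: binary_seqP; vm_compute.
move=> s s_gt0; have [s_lt40 | s_ge40] := ltnP s 40.
  by apply: base_seqs_autocorr; rewrite mem_iota s_gt0.
by rewrite !autocorr_ge_size // (leq_trans _ s_ge40).
Qed.
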